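(* There exist absolute constants $c>0$ and $T_0$ such that for every integer $T\ge T_0$ the following hold. (i) For every integer $N$ there exists a starting configuration $f_0:\mathbb{Z}\to\mathbb{N}$ such that, letting $g_0=f_0$ and letting $f_t$ and $g_t$ be the evolutions of the liar machine and the linear machine, respectively, $$|f_T(N)-g_T(N)|\ge c\log T.$$ (ii) For every interval $I=[a,b]\subset\mathbb{Z}$ of length $B=b-a\ge1$ there exists a starting configuration $f_0':\mathbb{Z}\to\mathbb{N}$ such that, letting $g_0'=f_0'$ and letting $f'_t$ and $g'_t$ be the evolutions of the liar machine and the linear machine, respectively, $$|f'_T(I)-g'_T(I)|\ge c\cdot\begin{cases}\sqrt T&\text{if }B>\sqrt T/2,\\ B\log(T/B^2)&\text{if }B\le\sqrt T/2.\end{cases}$$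
   Context: $\mathbb{N}=\{0,1,2,\dots\}$; $\log$ is the natural logarithm. For $h:\mathbb{Z}\to\mathbb{R}$ and $S\subset\mathbb{Z}$, $h(S)=\sum_{i\in S}h(i)$; $[a,b]=\{a,a+1,\dots,b\}$. A starting configuration is a map $f_0:\mathbb{Z}\to\mathbb{N}$ with finite support contained in $2\mathbb{Z}$ or in $2\mathbb{Z}+1$. Liar machine: given $f_t:\mathbb{Z}\to\mathbb{N}$ with finite support, define $\chi_t:\mathbb{Z}\to\{-1,0,1\}$ by $\chi_t(j)=0$ if $f_t(j)$ is even and $\chi_t(j)=(-1)^{\sum_{i<j}\chi_t(i)}$ if $f_t(j)$ is odd. Then $$f_{t+1}(j)=\frac{f_t(j-1)+f_t(j+1)+\chi_t(j-1)-\chi_t(j+1)}{2}.$$ Linear machine: given $g_t:\mathbb{Z}\to\mathbb{R}$, define $g_{t+1}(j)=\frac{g_t(j-1)+g_t(j+1)}{2}$. *)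

(* Defs.v *)
From HB Require Import structures.
From mathcomp Require Import all_boot all_order all_algebra.
From mathcomp Require Import all_classical all_reals all_analysis.
From mathcomp Require Import zify.

Set Implicit Arguments.
Unset Strict Implicit.
Unset Printing Implicit Defensive.
Import Order.TTheory GRing.Theory Num.Theory.
Local Open Scope classical_set_scope.
Local Open Scope ring_scope.

Definition supp (f : int -> nat) : set int := [set j | f j != 0%N].

Definition starting_configuration (f0 : int -> nat) : Prop :=
  finite_set (supp f0) /\
  (supp f0 `<=` [set j | exists k : int, j = 2 * k] \/
   supp f0 `<=` [set j | exists k : int, j = 2 * k + 1]).

(* The sum is over an infinite set, in the finite-support sense of fsbigop:
   chi vanishes wherever f does, so it has finite support when f does.  The
   exponent is an integer. *)
Definition liar_chi (f : int -> nat) (chi : int -> int) : Prop :=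
  forall j, chi j =
    if odd (f j) then (-1) ^ (\sum_(i \in [set i : int | i < j]) chi i) else 0.

Definition liar_step (f f' : int -> nat) : Prop :=
  exists2 chi : int -> int, liar_chi f chi &
    forall j, 2 * (f' j)%:Z =
      (f (j - 1))%:Z + (f (j + 1))%:Z + chi (j - 1) - chi (j + 1).

(* For finitely supported f0 this determines f: see liar_evolution_exists and
   liar_evolution_unique below. *)
Definition liar_evolution (f0 : int -> nat) (f : nat -> int -> nat) : Prop :=
  f 0%N = f0 /\ forall t, liar_step (f t) (f t.+1).

Definition linear_step (R : realType) (g : int -> R) : int -> R :=
  fun j => (g (j - 1) + g (j + 1)) / 2.

Definition linear_machine (R : realType) (g0 : int -> R) (t : nat) : int -> R :=
  iter t (@linear_step R) g0.

Definition real_config (R : realType) (f : int -> nat) : int -> R :=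
  fun j => (f j)%:R.

Definition sum_on (R : realType) (h : int -> R) (S : set int) : R :=
  \sum_(i \in S) h i.

Definition zinterval (a b : int) : set int := [set i | a <= i <= b].

Lemma finite_supp_bounds (f : int -> nat) : finite_set (supp f) ->
  exists m, forall j, supp f j -> `|j| <= m.
Proof.
move=> /finite_seqP[s sE]; exists (\sum_(i <- s) `|i|) => j; rewrite sE /= => js.
by rewrite (big_rem j js)/= lerDl sumr_ge0.
Qed.

Lemma finite_supp_bounded (f : int -> nat) (m : int) :
  (forall j, supp f j -> `|j| <= m) -> finite_set (supp f).
Proof.
move=> fm.
set s := [seq k%:Z - m | k <- iota 0 (absz (2 * m + 1))].
apply: (@sub_finite_set _ _ [set` s]); last exact: finite_seq.
move=> j /fm jm /=; apply/mapP; exists (absz (j + m)).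
  by rewrite mem_iota; lia.
by lia.
Qed.

Lemma sum_below (chi : int -> int) (m : int) (n : nat) :
  (forall i, i < m -> chi i = 0) ->
  \sum_(i \in [set i : int | i < m + n%:Z]) chi i =
  \sum_(0 <= k < n) chi (m + k%:Z).
Proof.
move=> chi0.
rewrite (@fsbigE _ _ _ _ _ [seq m + k%:Z | k <- iota 0 n]).
- rewrite big_map /index_iota subn0 big_seq_cond [RHS]big_seq.
  apply: eq_bigl => k; case kn: (k \in _) => //=.
  by rewrite mem_set//=; move: kn; rewrite mem_iota; lia.
- by rewrite map_inj_uniq ?iota_uniq// => i j; lia.
- by move=> i /= /mapP[k]; rewrite mem_iota => kn ->; lia.
- move=> i /= im ni; apply: chi0; apply: contrapT => /negP mi.
  move/negP: ni; apply; apply/mapP.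
  by exists (absz (i - m)); [rewrite mem_iota|]; lia.
Qed.

Lemma liar_chi_low f chi m : (forall j, supp f j -> `|j| <= m) ->
  liar_chi f chi -> forall i, i < - m -> chi i = 0.
Proof.
move=> fm chiP i im; rewrite chiP; have := fm i; rewrite /supp /=.
by case: (f i) => // n /(_ isT); lia.
Qed.

Lemma liar_chi_exists f : finite_set (supp f) -> exists chi, liar_chi f chi.
Proof.
move=> /finite_supp_bounds[m fm].
pose S := fix S n : int := if n is k.+1 then
  S k + (if odd (f (- m + k%:Z)) then (-1) ^ (S k) else 0) else 0.
pose chi (j : int) : int :=
  if - m <= j then S ((absz (j + m)).+1) - S (absz (j + m)) else 0.
have chi_low i : i < - m -> chi i = 0 by rewrite /chi; case: ifP => //; lia.
exists chi => j; case: (leP (- m) j) => mj; last first.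
  rewrite chi_low//; have := fm j; rewrite /supp /=.
  by case: (f j) => // n /(_ isT); lia.
have jE : j = - m + (absz (j + m))%:Z by lia.
rewrite {2 3}jE sum_below // (eq_bigr (fun k => S k.+1 - S k)); last first.
  move=> k _; rewrite /chi ifT; last by lia.
  by rewrite (_ : absz _ = k)//; lia.
by rewrite telescope_sumr// {2}/S subr0 /chi mj /= addrC addKr.
Qed.

Lemma liar_chi_unique f chi chi' : finite_set (supp f) ->
  liar_chi f chi -> liar_chi f chi' -> chi = chi'.
Proof.
move=> /finite_supp_bounds[m fm] c c'; apply/funext => j.
have l := liar_chi_low fm c; have l' := liar_chi_low fm c'.
case: (ltP j (- m)) => mj; first by rewrite l// l'.
rewrite (_ : j = - m + (absz (j + m))%:Z); last by lia.
elim/ltn_ind: (absz (j + m)) => n IH.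
rewrite c c' !sum_below//; congr (if _ then _ ^ _ else _).
by apply: eq_big_nat => k /andP[_ /IH].
Qed.

Lemma liar_chi_odd f chi j : liar_chi f chi ->
  exists e : int, (f j)%:Z + chi j = 2 * e /\ (`|chi j| <= (f j)%:Z).
Proof.
move=> ->; case: ifPn => [fo|/negbTE fe].
  have signE (z : int) : (-1 : int) ^ z = 1 \/ (-1 : int) ^ z = -1.
    have h k : (-1 : int) ^+ k = 1 \/ (-1 : int) ^+ k = -1.
      by rewrite -signr_odd; case: odd; [right|left].
    case: z => k; first exact: h.
    by rewrite NegzE -invr_expz -exprnP; case: (h k.+1) => ->; [left|right].
  have fE : (f j : nat) = ((f j)./2.*2).+1 by rewrite -[LHS]odd_double_half fo.
  case: (signE (\sum_(i \in [set i : int | i < j]) chi i)) => ->.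
    by exists (f j)./2.+1%:Z; lia.
  by exists (f j)./2%:Z; lia.
by exists (f j)./2%:Z; lia.
Qed.

Lemma liar_step_supp f f' : finite_set (supp f) -> liar_step f f' ->
  finite_set (supp f').
Proof.
move=> /finite_supp_bounds[m fm] [chi c fE].
apply: (@finite_supp_bounded _ (m + 1)) => j; rewrite /supp /= => f'j.
have [e1 [_ h1]] := liar_chi_odd (j - 1) c.
have [e2 [_ h2]] := liar_chi_odd (j + 1) c.
have := fE j; have := fm (j - 1); have := fm (j + 1); rewrite /supp /=.
case: eqP => [z1 _|_ /(_ isT)]; last lia.
case: eqP => [z2 _|_ /(_ isT)]; last lia.
lia.
Qed.

Lemma liar_step_exists f : finite_set (supp f) -> exists f', liar_step f f'.
Proof.
move=> /liar_chi_exists[chi c].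
have h j : exists n : nat, 2 * n%:Z =
    (f (j - 1))%:Z + (f (j + 1))%:Z + chi (j - 1) - chi (j + 1).
  have [e1 [? h1]] := liar_chi_odd (j - 1) c.
  have [e2 [? h2]] := liar_chi_odd (j + 1) c.
  by exists (absz (e1 + e2 - chi (j + 1))%R); lia.
by have [f' f'P] := choice h; exists f', chi.
Qed.

Lemma liar_step_unique f f' f'' : finite_set (supp f) ->
  liar_step f f' -> liar_step f f'' -> f' = f''.
Proof.
move=> ff [c cP h] [c' c'P]; rewrite -(liar_chi_unique ff cP c'P) => h'.
by apply/funext => j; have := h j; have := h' j; lia.
Qed.

Lemma liar_evolution_exists f0 : finite_set (supp f0) ->
  exists f, liar_evolution f0 f.
Proof.
move=> ff0.
pose next f := xget f [set f' | liar_step f f'].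
have nextP f : finite_set (supp f) -> liar_step f (next f).
  by move=> /liar_step_exists; exact: xgetPex.
have fin t : finite_set (supp (iter t next f0)).
  by elim: t => //= t IH; exact: liar_step_supp IH (nextP _ IH).
by exists (fun t => iter t next f0); split=> // t; exact: nextP.
Qed.

Lemma liar_evolution_unique f0 f f' : finite_set (supp f0) ->
  liar_evolution f0 f -> liar_evolution f0 f' -> f = f'.
Proof.
move=> ff0 [e s] [e' s']; apply/funext => t.
suff [] : f t = f' t /\ finite_set (supp (f t)) by [].
elim: t => [|t [E F]]; first by rewrite e e'.
split; last exact: liar_step_supp (s t).
by apply: (liar_step_unique F (s t)); rewrite E.
Qed.

(* Main.v *)
Require Import Defs.
From mathcomp Require Import all_boot all_order all_algebra.
From mathcomp Require Import all_classical all_reals all_analysis.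
From mathcomp Require Import zify ring lra.

(** The discrepancy is driven by the spins [chi] alone.  One liar step is one
    linear step plus half the difference of the spins of the two neighbours,
    so after [T] steps the discrepancy on an interval is a sum over times [t]
    of the linear evolution of the spins at time [t], run for the remaining
    [s = T - 1 - t] steps.  Summed over the interval, that evolution telescopes
    to a difference of its values at two sites [alpha < beta] just outside or
    at the ends of the interval ([liar_discrepancy], [telescope_two]).

    The adversary controls all spins.  Adding [2 ^ T * h] chips to the initial
    configuration changes no parity before time [T] and changes those at time
    [T] by the Pascal transform of [h], which is invertible modulo 2; hence the
    parities of all piles, on a left half-line and up to any given time, can be
    prescribed freely ([parity_forcing]).  The spins alternate in sign along the
    odd piles, so with exactly two odd piles [u < v] they are [+1] and [-1].

    At each time [u] is placed at distance [x] to the left of [alpha] and [v] at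
    distance [x] to the right of [beta].  The resulting gain is
    [H(x) - H(x + D)] with [D = beta - alpha] and [H(y)] the probability that a
    simple random walk is at [y] after [s] steps
    ([linear_machine_dipole]).  If [B <= D] and [B ^ 2 <= s], some [x] gives a
    gain of order [B / s] ([exists_binomial_drop]): [H] drops by
    half of its maximum, which is of order [1 / sqrt s], within distance
    [O(sqrt s)], and that stretch consists of [O(sqrt s / B)] steps of
    length [D], so one of the steps has an average share of the drop.

    Summing [B / s] over [B ^ 2 <= s < T] gives [B * ln (T / B ^ 2)] up to a
    constant ([liar_interval_lower_bound]).  A single site is an interval with
    [B = 1]; for intervals longer than [sqrt T / 2] the same bound is used with
    [B] about [sqrt T / 2], where the logarithm is at least [ln 4]. *)

Set Implicit Arguments.
Unset Strict Implicit.
Unset Printing Implicit Defensive.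
Import Order.TTheory GRing.Theory Num.Theory.
Local Open Scope classical_set_scope.
Local Open Scope ring_scope.

(** * Iterated sums of neighbours *)

(** Twice the linear step.  Without the division it makes sense for chip counts
    as well, and so serves both the linear machine and parity arguments. *)
Definition pascal {V : nmodType} (g : int -> V) (j : int) : V :=
  g (j - 1) + g (j + 1).

Definition on_parity {V : nmodType} (p : int) (g : int -> V) :=
  forall j : int, ~~ (2 %| j - p)%Z -> g j = 0.

(** Finite speed of propagation, from the right: parities will be controlled on
    left half-lines only. *)
Lemma iter_pascal_local (V : nmodType) (g g' : int -> V) (M : int) n :
  (forall j, j <= M + n%:Z -> g j = g' j) ->
  forall j, j <= M -> iter n pascal g j = iter n pascal g' j.
Proof.
elim: n M => [|n IH] M gg' j jM; first by apply: gg'; lia.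
have H i : i <= M + 1 -> iter n pascal g i = iter n pascal g' i.
  by apply: IH => k kM; apply: gg'; lia.
by rewrite /= /pascal !H//; lia.
Qed.

Lemma iter_pascal_parity (V : nmodType) p (g : int -> V) n :
  on_parity p g -> on_parity (p + n%:Z) (iter n pascal g).
Proof.
move=> pg; elim: n => [|n IH] j jp; first by apply: pg; move: jp; rewrite addr0.
by rewrite /= /pascal !IH ?addr0//; lia.
Qed.

(** The number of nearest-neighbour paths of length [n] from [u], with [m] of the
    steps to the right. *)
Lemma iter_pascal_delta (V : pzSemiRingType) (u : int) n m :
  iter n pascal (fun j => (j == u)%:R : V) (u + 2 * m%:Z - n%:Z) = 'C(n, m)%:R.
Proof.
elim: n m => [|n IH] m.
  by rewrite /= bin0n; congr (_%:R); lia.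
rewrite /= /pascal (_ : _ + 1 = u + 2 * m%:Z - n%:Z); last lia.
rewrite IH; case: m => [|m]; last first.
  rewrite (_ : _ - 1 = u + 2 * m%:Z - n%:Z); last lia.
  by rewrite IH binS addrC -natrD.
rewrite (@iter_pascal_local _ _ (fun=> 0) (u - n%:Z - 1)) => [|j ju|]; last lia.
  have -> : iter n pascal (fun=> 0 : V) = fun=> 0.
    by elim: n {IH} => //= n ->; apply/funext => j; rewrite /pascal addr0.
  by rewrite add0r !bin0.
by rewrite (_ : j == u = false)//; lia.
Qed.

Lemma iter_pascal_delta_sym (V : pzSemiRingType) (u : int) n m :
  iter n pascal (fun j => (j == u)%:R : V) (u + n%:Z - 2 * m%:Z) = 'C(n, m)%:R.
Proof.
have [mn|nm] := leqP m n.
  by rewrite -bin_sub// -(iter_pascal_delta _ u); congr (iter _ _ _ _); lia.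
rewrite bin_small// (@iter_pascal_local _ _ (fun=> 0) (u - n%:Z - 1)) => [|j ju|]; last lia.
  by elim: {nm} n (_ - _) => //= n IH j; rewrite /pascal !IH addr0.
by rewrite (_ : j == u = false)//; lia.
Qed.

Lemma odd_iter_pascal (g g' : int -> nat) n :
  (forall j, odd (g j) = odd (g' j)) ->
  forall j, odd (iter n pascal g j) = odd (iter n pascal g' j).
Proof.
by move=> gg'; elim: n => //= n IH j; rewrite /pascal !oddD !IH.
Qed.

(** Modulo 2 the equation [h (j + 1) = d j - h (j - 1)] determines [h] from left
    to right: [h j] is the sum of [d (j - 1)], [d (j - 3)], and so on.  The sum
    below is long enough to exhaust the indices from [m] on. *)
Lemma pascal_preimage p (m : int) (d : int -> nat) :
  on_parity p d -> (forall j, j < m -> d j = 0%N) ->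
  exists h : int -> nat, [/\ on_parity (p - 1) h, forall j, j < m -> h j = 0%N
    & forall j, odd (pascal h j) = odd (d j)].
Proof.
move=> pd d0.
pose h (j : int) := (\sum_(k < `|j - m|) d (j - 1 - 2 * k%:Z)%R)%N.
have h0 j : j <= m -> h j = 0%N.
  by move=> jm; rewrite /h big1// => k _; apply: d0; lia.
exists h; split=> [j jp|j jm|j].
- by rewrite /h big1// => k _; apply: pd; lia.
- by apply: h0; lia.
have [jm|mj] := ltP j m.
  by rewrite /pascal !h0 ?d0//; lia.
suff hS : h (j + 1) = (d j + h (j - 1)%R)%N by rewrite /pascal hS !oddD; case: odd; case: odd.
have dE (k : nat) : d (j + 1 - 1 - 2 * k.+1%:Z) = d (j - 1 - 1 - 2 * k%:Z).
  by congr d; lia.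
have d00 : d (j + 1 - 1 - 2 * 0%:Z) = d j by congr d; lia.
have [->|jm] := eqVneq j m.
  rewrite (h0 (m - 1)); last lia.
  rewrite /h (_ : absz (m + 1 - m)%R = 1%N); last lia.
  by rewrite big_ord1 addn0 /=; congr d; lia.
rewrite /h (_ : absz (j + 1 - m)%R = (absz (j - 1 - m)%R).+2); last lia.
(* The sum for [j + 1] has two more terms than the one for [j - 1]: the first is
   [d j], and the last vanishes because its index is below [m]. *)
rewrite big_ord_recl /= d00; congr addn.
under eq_bigr => k _ do rewrite /bump leq0n add1n dE.
by rewrite big_ord_recr /= [X in (_ + X)%N]d0 ?addn0//; lia.
Qed.

Lemma iter_pascal_preimage p (m : int) (d : int -> nat) n :
  on_parity (p + n%:Z) d -> (forall j, j < m -> d j = 0%N) ->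
  exists h : int -> nat, [/\ on_parity p h, forall j, j < m -> h j = 0%N
    & forall j, odd (iter n pascal h j) = odd (d j)].
Proof.
elim: n d => [|n IH] d pd d0; first by exists d; rewrite addr0 in pd.
have [d1 [pd1 d10 d1d]] := pascal_preimage pd d0.
have [|h [ph h0 hd]] := IH d1 _ d10; first by move=> j jp; apply: pd1; lia.
exists h; split=> // j; rewrite iterS -d1d; exact: (@odd_iter_pascal _ _ 1).
Qed.

(** The solution of the recursion need not vanish far to the right, even when [d]
    does; by locality it may be cut off beyond [M + n], which costs the control of
    the parities beyond [M]. *)
Lemma finite_iter_pascal_preimage p (M : int) (d : int -> nat) n :
  finite_set (supp d) -> on_parity (p + n%:Z) d ->
  exists h : int -> nat, [/\ finite_set (supp h), on_parity p h
    & forall j, j <= M -> odd (iter n pascal h j) = odd (d j)].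
Proof.
move=> /finite_supp_bounds[m dm] pd.
have [|h [ph h0 hd]] := iter_pascal_preimage (m := - m) pd.
  by move=> j jm; have := dm j; rewrite /supp /=; case: (d j) => // k /(_ isT); lia.
exists (fun j => if j <= M + n%:Z then h j else 0%N); split.
- apply: (@finite_supp_bounded _ (`|m| + `|M| + n%:Z)) => j.
  rewrite /supp /=; case: ifP => // jM.
  by have [/h0 ->//|] := ltP j (- m); lia.
- by move=> j jp; case: ifP => // _; exact: ph.
move=> j jM; rewrite -hd; congr odd.
by apply: iter_pascal_local jM => i ->.
Qed.

(** * Forcing the parities of the piles *)

Lemma liar_evolution_finite f0 f t : finite_set (supp f0) ->
  liar_evolution f0 f -> finite_set (supp (f t)).
Proof.
move=> ff0 [e s]; elim: t => [|t IH]; first by rewrite e.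
exact: liar_step_supp (s t).
Qed.

Lemma liar_step_parity p f f' : liar_step f f' ->
  on_parity p f -> on_parity (p + 1) f'.
Proof.
move=> [chi c fE] pf j jp.
have [_ [_ h1]] := liar_chi_odd (j - 1) c.
have [_ [_ h2]] := liar_chi_odd (j + 1) c.
have := pf (j - 1); have := pf (j + 1).
move=> /(_ ltac:(lia)) z2 /(_ ltac:(lia)) z1.
have := fE j; lia.
Qed.

Lemma liar_evolution_parity p f0 f t : liar_evolution f0 f ->
  on_parity p f0 -> on_parity (p + t%:Z) (f t).
Proof.
move=> [e s] pf; elim: t => [|t IH]; first by rewrite e addr0.
by rewrite (_ : p + _ = p + t%:Z + 1); [exact: liar_step_parity (s t) IH|lia].
Qed.

Lemma finite_supp_add (f h : int -> nat) c : finite_set (supp f) ->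
  finite_set (supp h) -> finite_set (supp (fun j => f j + c * h j)%N).
Proof.
move=> ff fh; apply: (@sub_finite_set _ _ (supp f `|` supp h)).
  move=> j; rewrite /supp /= addn_eq0 muln_eq0 negb_and negb_or.
  by move=> /orP[?|/andP[_ ?]]; [left|right].
by rewrite finite_setU.
Qed.

(** Before time [T] the added chips form even piles, so they leave the spins alone
    and are split evenly. *)
Lemma liar_evolution_add f0 f f' (h : int -> nat) T :
  finite_set (supp f0) -> finite_set (supp h) -> liar_evolution f0 f ->
  liar_evolution (fun j => f0 j + 2 ^ T * h j)%N f' ->
  forall t, (t <= T)%N ->
    forall j, f' t j = (f t j + 2 ^ (T - t) * iter t pascal h j)%N.
Proof.
move=> ff0 fh [e s] e'.
have fin' := finite_supp_add (2 ^ T) ff0 fh.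
elim=> [|t IH] tT; first by rewrite e'.1 e subn0.
have {}IH : f' t = fun j => (f t j + 2 ^ (T - t) * iter t pascal h j)%N.
  by apply/funext; apply: IH; exact: ltnW.
have TtE : (2 ^ (T - t) = 2 * 2 ^ (T - t.+1))%N by rewrite -expnS subnSK.
suff -> : f' t.+1 = fun j => (f t.+1 j + 2 ^ (T - t.+1) * iter t.+1 pascal h j)%N by [].
apply: (liar_step_unique (liar_evolution_finite t fin' e') (e'.2 t)).
rewrite IH TtE; have [chi c fE] := s t; exists chi => j.
  by rewrite c oddD -mulnA oddM addbF.
have := fE j; rewrite iterS {1}/pascal.
move: (2 ^ _)%N (iter t pascal h (j - 1)%R) (iter t pascal h (j + 1)%R) => q x y E.
rewrite (_ : x + y = (x + y)%N)// mulnDr.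
lia.
Qed.

(** Induction on time: the parities at time [T] are corrected by adding
    [2 ^ T * h] chips, where [h] is a preimage modulo 2 of the required change
    under [T] Pascal steps. *)
Lemma parity_forcing p (rho : nat -> int -> bool) (M : int) T :
  (forall t, finite_set [set j | rho t j]) ->
  (forall t j, rho t j -> (2 %| j - (p + t%:Z))%Z) ->
  exists f0 f, [/\ finite_set (supp f0), on_parity p f0, liar_evolution f0 f &
    forall t j, (t < T)%N -> j <= M -> odd (f t j) = rho t j].
Proof.
move=> frho prho; elim: T => [|T [f0 [f [ff0 pf0 ef fr]]]].
  have f00 : finite_set (supp (fun=> 0%N)).
    by apply: (@finite_supp_bounded _ 0) => j; rewrite /supp /=.
  have [f ef] := liar_evolution_exists f00.
  by exists (fun=> 0%N), f.
pose d j : nat := odd (f T j) (+) rho T j.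
have fd : finite_set (supp d).
  apply: (@sub_finite_set _ _ (supp (f T) `|` [set j | rho T j])).
    move=> j; rewrite /supp /d /=; case: (rho T j); first by right.
    by rewrite addbF; case: (f T j) => //; left.
  by rewrite finite_setU; split; [exact: liar_evolution_finite ef|exact: frho].
have pd : on_parity (p + T%:Z) d.
  move=> j jp; rewrite /d (liar_evolution_parity (t := T) ef pf0 jp) /=.
  by case: (boolP (rho T j)) => // /prho; rewrite (negbTE jp).
have [h [fh ph hd]] := finite_iter_pascal_preimage M fd pd.
pose f0' j := (f0 j + 2 ^ T * h j)%N.
have ff0' : finite_set (supp f0') := finite_supp_add (2 ^ T) ff0 fh.
have [f' ef'] := liar_evolution_exists ff0'.
have f'E := liar_evolution_add ff0 fh ef ef'.
exists f0', f'; split=> // [j jp|t j].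
  by rewrite /f0' pf0// ph// muln0.
rewrite ltnS leq_eqVlt => /orP[/eqP->|tT] jM; rewrite f'E ?oddD ?oddM//.
  by rewrite subnn /= hd// /d oddb; case: (odd _); case: (rho _ _).
  by rewrite oddX orbF subn_eq0 leqNgt tT /= addbF fr.
exact: ltnW.
Qed.

(** Spins are determined from left to right, so parities known up to [M] give the
    spins up to [M]; the first odd pile gets [+1] and the second one [-1]. *)
Lemma liar_chi_pair f chi (M u v : int) : u < v -> liar_chi f chi ->
  (forall j, j <= M -> odd (f j) = (j == u) || (j == v)) ->
  forall j, j <= M -> chi j = (j == u)%:R - (j == v)%:R.
Proof.
move=> uv c fM.
have off i : i <= M -> i != u -> i != v -> chi i = 0.
  by move=> iM iu iv; rewrite c fM// (negbTE iu) (negbTE iv).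
have chiu : u <= M -> chi u = 1.
  move=> uM; rewrite c fM// eqxx/= fsbig1 ?expr0z// => i /= iu.
  by apply: off; lia.
move=> j jM; have [ju|ju] := eqVneq j u.
  by rewrite ju chiu -?ju// (_ : j == v = false) ?subr0//; lia.
rewrite sub0r; have [jv|jv] := eqVneq j v; last by rewrite off ?oppr0.
rewrite jv in jM *; rewrite c fM// eqxx orbT (fsbigE [:: u])//=.
- by rewrite big_cons big_nil mem_set//= chiu ?addr0//; lia.
- by move=> i; rewrite /= mem_seq1 => /eqP ->.
- by move=> i /= iv; rewrite mem_seq1 => iu; apply: off; lia.
Qed.

(** * Differences of binomial coefficients *)

Lemma central_binomial_step n :
  (4 * n * 'C(n.*2, n) ^ 2 <= n.+1 * 'C(n.*2.+1, n) ^ 2)%N.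
Proof.
have := mul_bin_down n.*2.+1 n; rewrite /= (_ : n.*2.+1 - n = n.+1)%N; last lia.
move: 'C(n.*2, n) 'C(n.*2.+1, n) => a b ab.
rewrite -(leq_pmul2l (ltn0Sn n)).
have -> : (n.+1 * (n.+1 * b ^ 2) = (n.*2.+1 * a) ^ 2)%N by rewrite ab; lia.
have -> : ((n.*2.+1 * a) ^ 2 = n.+1 * (4 * n * a ^ 2) + a ^ 2)%N by rewrite -muln2; lia.
lia.
Qed.

Lemma even_central_binomial_ge n : (0 < n)%N ->
  (16 ^ n <= 4 * n * 'C(n.*2, n) ^ 2)%N.
Proof.
elim: n => // -[_ _|n IH _]; first by [].
have := central_binomial_step n.+1; have := IH isT.
have -> : ('C(n.+2.*2, n.+2) = 2 * 'C(n.+1.*2.+1, n.+1))%N.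
  apply/eqP; rewrite -(eqn_pmul2l (ltn0Sn n.+1)) -mul_bin_diag !doubleS /=.
  by apply/eqP; rewrite -muln2; lia.
rewrite (expnS 16 n.+1) (expnMn 2); move: (16 ^ _)%N ('C(_, _) ^ 2)%N ('C(_, _) ^ 2)%N; lia.
Qed.

(** The central binomial coefficient is at least [2 ^ s / (2 * sqrt s)]. *)
Lemma central_binomial_ge s : (0 < s)%N ->
  (4 ^ s <= 4 * s * 'C(s, uphalf s) ^ 2)%N.
Proof.
rewrite -(odd_double_half s); move: (s./2) (odd s) => n [] s0.
  rewrite (_ : uphalf _ = n.+1); last lia.
  have -> : 'C(true + n.*2, n.+1) = 'C(n.*2.+1, n).
    by rewrite -bin_sub; [congr 'C(_, _)|]; lia.
  rewrite add1n expnS -mul2n (expnM 4 2).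
  case: n {s0} => // n.
  have := central_binomial_step n.+1; have := even_central_binomial_ge (ltn0Sn n).
  rewrite -mul2n; move: (16 ^ _)%N ('C(_, _) ^ 2)%N ('C(_, _) ^ 2)%N; lia.
rewrite (_ : uphalf _ = n); last lia.
case: n s0 => // n _.
have := even_central_binomial_ge (ltn0Sn n).
rewrite add0n -{2}mul2n expnM; move: (16 ^ _)%N ('C(_, _) ^ 2)%N; lia.
Qed.

Lemma binomial_decreasing s m : (uphalf s <= m)%N -> ('C(s, m.+1) <= 'C(s, m))%N.
Proof.
move=> sm; rewrite -(leq_pmul2l (ltn0Sn m)) mul_bin_left leq_mul2r.
by apply/orP; right; lia.
Qed.

Lemma binomial_antitone s m k : (uphalf s <= m)%N -> ('C(s, m + k) <= 'C(s, m))%N.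
Proof.
move=> sm; elim: k => [|k IH]; first by rewrite addn0.
by rewrite addnS (leq_trans _ IH)// binomial_decreasing//; lia.
Qed.

Lemma sum_binomial s : (\sum_(0 <= i < s.+1) 'C(s, i) = 2 ^ s)%N.
Proof.
rewrite -[2%N]/(1 + 1)%N expnDn big_mkord; apply: eq_bigr => i _.
by rewrite !exp1n !muln1.
Qed.

(** The [k + 1] coefficients from [m] to [m + k] are at least the last of them, and
    together at most [2 ^ s]. *)
Lemma binomial_tail s m k : (uphalf s <= m)%N -> (k.+1 * 'C(s, m + k) <= 2 ^ s)%N.
Proof.
move=> sm; have [mks|smk] := leqP (m + k) s; last by rewrite bin_small ?muln0.
rewrite -sum_binomial (big_cat_nat (n := m))//=; last lia.
rewrite (big_cat_nat (m := m) (n := (m + k).+1))//=; [|lia..].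
apply: leq_trans (leq_addl _ _); apply: leq_trans (leq_addr _ _).
rewrite (_ : k.+1 = (m + k).+1 - m)%N; last lia.
rewrite -sum_nat_const_nat big_nat [leqRHS]big_nat.
apply: leq_sum => i imk.
by rewrite (_ : m + k = i + (m + k - i))%N ?binomial_antitone//; lia.
Qed.

(** With [r = sqrt s] and [n] about [4 * r / h] steps of length [h] from the centre,
    the coefficient falls from at least [2 ^ s / (2 * r)] to at most
    [2 ^ s / (4 * r)]; as [n <= 9 * r / B], one step accounts for at least
    [2 ^ s / (4 * r)] divided by [9 * r / B]. *)
Lemma exists_binomial_drop (R : realType) s h (B : R) :
  (0 < s)%N -> 0 < B -> B <= 2 * h%:R -> B ^+ 2 <= s%:R ->
  exists2 m, (uphalf s <= m)%N &
    B / (36 * s%:R) * 2 ^+ s <= 'C(s, m)%:R - 'C(s, m + h)%:R.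
Proof.
move=> s0 B0 Bh Bs; pose m := uphalf s.
have h0 : 0 < h%:R :> R by lra.
pose r : R := Num.sqrt s%:R.
have r0 : 0 < r by rewrite sqrtr_gt0 ltr0n.
have r2 : r ^+ 2 = s%:R by rewrite sqr_sqrtr ?ler0n.
have Br : B <= r by rewrite -(ler_pXn2r (n := 2)) ?r2// nnegrE ltW.
pose n := (Num.truncn (4 * r / h%:R)).+1.
have /andP[nlo nhi] : (4 * r / h%:R < n%:R) && (n%:R <= 9 * r / B).
  have x0 : 0 <= 4 * r / h%:R by rewrite divr_ge0 ?mulr_ge0 ?ltW.
  have /andP[lo hi] := truncn_itv x0.
  rewrite /n hi /= -natr1.
  have h1 : 4 * r / h%:R <= 8 * r / B.
    by rewrite ler_pdivrMr// mulrAC ler_pdivlMr//; nra.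
  have h2 : 1 <= r / B by rewrite ler_pdivlMr// mul1r.
  lra.
apply: contrapT => small.
pose drop k : R := 'C(s, m + k * h)%:R - 'C(s, m + k.+1 * h)%:R.
have dropS k : drop k < B / (36 * s%:R) * 2 ^+ s.
  rewrite ltNge; apply/negP => le; apply: small; exists (m + k * h)%N => //.
    exact: leq_addr.
  by move: le; rewrite /drop mulSn (addnC h) addnA.
have sumS : \sum_(k < n) drop k < n%:R * (B / (36 * s%:R) * 2 ^+ s).
  rewrite (_ : n%:R * _ = \sum_(k < n) B / (36 * s%:R) * 2 ^+ s); last first.
    by rewrite sumr_const card_ord mulr_natl.
  by apply: ltr_sum => //; apply/hasP; exists ord0; rewrite ?mem_index_enum.
have sumE : \sum_(k < n) drop k = 'C(s, m)%:R - 'C(s, m + n * h)%:R.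
  elim: (n) => [|k IH]; first by rewrite big_ord0 mul0n addn0 subrr.
  by rewrite big_ord_recr /= IH /drop; lra.
have p0 : 0 < 2 ^+ s :> R by rewrite exprn_gt0.
have top : 2 ^+ s <= 2 * r * 'C(s, m)%:R.
  rewrite -(ler_pXn2r (n := 2)) ?nnegrE ?(ltW p0)//; last first.
    by rewrite mulr_ge0 ?mulr_ge0 ?ler0n ?ltW.
  have := central_binomial_ge s0; rewrite -(ler_nat R) !natrM !natrX => le.
  by rewrite !exprMn r2 -exprM mulnC exprM (_ : 2 ^+ 2 = 4%:R)// -natrX.
have bot : 4 * r * 'C(s, m + n * h)%:R <= 2 ^+ s.
  have rnh : 4 * r <= (n * h).+1%:R.
    by rewrite -[(n * h).+1%:R]natr1 natrM; move: nlo; rewrite ltr_pdivrMr//; lra.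
  have := binomial_tail (n * h) (leqnn m).
  rewrite -(ler_nat R) natrM natrX; apply: le_trans.
  by rewrite ler_wpM2r.
have up : n%:R * (B / (36 * s%:R) * 2 ^+ s) <= 2 ^+ s / (4 * r).
  rewrite ler_pdivlMr ?mulr_gt0// -r2.
  have -> : n%:R * (B / (36 * r ^+ 2) * 2 ^+ s) * (4 * r) =
      n%:R * (B / (9 * r)) * 2 ^+ s by field; lra.
  rewrite -[leRHS]mul1r ler_wpM2r ?(ltW p0)//.
  by move: nhi; rewrite ler_pdivlMr// mulrA ler_pdivrMr ?mulr_gt0// mul1r.
have lo : 2 ^+ s / (4 * r) <= 'C(s, m)%:R - 'C(s, m + n * h)%:R.
  by rewrite ler_pdivrMr ?mulr_gt0//; lra.
by move: (lt_le_trans sumS (le_trans up lo)); rewrite sumE ltxx.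
Qed.

(** For small [s] the two positions are put out of reach, where there is neither
    gain nor loss. *)
Lemma exists_binomial_drop_total (R : realType) s h (B : nat) :
  (0 < B)%N -> (B <= 2 * h)%N ->
  exists2 m, (uphalf s <= m)%N &
    (if (B ^ 2 <= s)%N then B%:R / (36 * s%:R) else 0) <=
    ('C(s, m)%:R - 'C(s, m + h)%:R) / 2 ^+ s :> R.
Proof.
move=> B0 Bh; case: leqP => Bs.
  have [||||m ms mB] := @exists_binomial_drop R s h B%:R _ _ _ _.
  - by apply: leq_trans Bs; rewrite expn_gt0 B0.
  - by rewrite ltr0n.
  - by rewrite -natrM ler_nat.
  - by rewrite -natrX ler_nat.
  by exists m => //; rewrite ler_pdivlMr ?exprn_gt0.
exists s.+1; first lia.
by rewrite !bin_small ?subrr ?mul0r//; lia.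
Qed.

Lemma ln_ratio_le_sum (R : realType) q T : (0 < q)%N -> (q <= T)%N ->
  ln (T%:R / q%:R) <= \sum_(q <= s < T) s%:R^-1 :> R.
Proof.
move=> q0; elim: T => [|T IH]; first by rewrite leqNgt q0.
rewrite leq_eqVlt => /orP[/eqP<-|qT].
  by rewrite big_geq// divff ?ln1// pnatr_eq0 -lt0n.
have T0 : (0 : R) < T%:R by rewrite ltr0n (leq_trans q0).
have q0' : (0 : R) < q%:R by rewrite ltr0n.
rewrite big_nat_recr//=.
have -> : T.+1%:R / q%:R = T%:R / q%:R * (1 + T%:R^-1) :> R.
  by rewrite -natr1; field; lra.
rewrite lnM ?posrE ?divr_gt0// ?addr_gt0 ?invr_gt0//.
rewrite lerD ?IH// le_ln1Dx//.
by apply: lt_trans (_ : 0 < _); rewrite ?invr_gt0//; lra.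
Qed.

(** * The discrepancy of a chain of dipoles *)

Lemma linear_machineE (R : realType) (g : int -> R) s j :
  linear_machine g s j = iter s pascal g j / 2 ^+ s.
Proof.
elim: s j => [|s IH] j; first by rewrite /linear_machine /= divr1.
rewrite /linear_machine iterS /linear_step -!/(linear_machine _ _ _) !IH.
by rewrite /= /pascal exprS; field; rewrite expf_neq0.
Qed.

Lemma linear_machineS (R : realType) (g : int -> R) s j :
  linear_machine g s.+1 j =
  (linear_machine g s (j - 1) + linear_machine g s (j + 1)) / 2.
Proof. by []. Qed.

(** Duhamel formula for the inhomogeneous linear recursion satisfied by the liar
    machine. *)
Lemma liar_discrepancy (R : realType) f0 f (chi : nat -> int -> int) T j :
  f 0%N = f0 ->
  (forall t j, 2 * (f t.+1 j)%:Z =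
     (f t (j - 1))%:Z + (f t (j + 1))%:Z + chi t (j - 1) - chi t (j + 1)) ->
  real_config R (f T) j - linear_machine (real_config R f0) T j =
  \sum_(t < T) (linear_machine (fun i => (chi t i)%:~R) (T - t.+1) (j - 1)
              - linear_machine (fun i => (chi t i)%:~R) (T - t.+1) (j + 1)) / 2.
Proof.
move=> f00 fS; elim: T j => [|T IH] j; first by rewrite big_ord0 f00 subrr.
rewrite linear_machineS big_ord_recr /= subnn.
have E t : (t < T)%N -> (T.+1 - t.+1 = (T - t.+1).+1)%N by lia.
under eq_bigr => t _ do rewrite E// !linear_machineS.
have := congr1 (fun z : int => z%:~R : R) (fS T j).
rewrite !(rmorphM, rmorphD, rmorphN) /= -!pmulrn => {}fS.
rewrite (_ : \sum_(i < T) _ =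
  ((real_config R (f T) (j - 1) - linear_machine (real_config R f0) T (j - 1)) +
   (real_config R (f T) (j + 1) - linear_machine (real_config R f0) T (j + 1))) / 2);
  last first.
  rewrite !IH -big_split /= mulr_suml; apply: eq_bigr => i _.
  by rewrite !(addrK, subrK); field.
move: fS; rewrite /real_config /linear_machine /=; lra.
Qed.

Lemma sum_on_zinterval (R : realType) (h : int -> R) (a : int) n :
  sum_on h (zinterval a (a + n%:Z)) = \sum_(k < n.+1) h (a + k%:Z).
Proof.
rewrite (_ : n%:Z = n.+1%:Z - 1); last lia.
move: n.+1 => N; rewrite /sum_on (@fsbigE _ _ _ _ _ [seq a + k%:Z | k <- iota 0 N]).
- rewrite big_map -(big_mkord xpredT (fun k => h (a + k%:Z))) /index_iota subn0.
  rewrite big_seq_cond [RHS]big_seq; apply: eq_bigl => k.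
  case kn: (k \in _) => //=; rewrite mem_set// /zinterval /=.
  by move: kn; rewrite mem_iota; lia.
- by rewrite map_inj_uniq ?iota_uniq// => i j; lia.
- by move=> i /= /mapP[k]; rewrite mem_iota /zinterval /= => kn ->; lia.
- move=> i; rewrite /zinterval /= => iab /mapP; case.
  by exists `|i - a|%N; rewrite ?mem_iota; lia.
Qed.

Lemma telescope_two (R : realType) (phi : int -> R) (a : int) n :
  \sum_(k < n) (phi (a + k%:Z - 1) - phi (a + k%:Z + 1)) / 2 =
  (phi (a - 1) + phi a - phi (a + n%:Z - 1) - phi (a + n%:Z)) / 2.
Proof.
elim: n => [|n IH]; first by rewrite big_ord0 addr0; lra.
rewrite big_ord_recr /= IH (_ : a + n.+1%:Z = a + n%:Z + 1); last lia.
by rewrite addrK; lra.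
Qed.

Lemma iter_pascalB (V : zmodType) (g g' : int -> V) s j :
  iter s pascal (fun i => g i - g' i) j = iter s pascal g j - iter s pascal g' j.
Proof.
elim: s j => //= s IH j; rewrite /pascal !IH.
by rewrite opprD addrACA.
Qed.

(** The spins of a configuration whose odd piles are exactly [u < v]. *)
Definition dipole (R : realType) (u v : int) : int -> R :=
  fun j => (j == u)%:R - (j == v)%:R.

(** Here [u] lies [2 * m - s] to the left of [alpha] and [v] as far to the right
    of [alpha + 2 * h]; the two end sites see opposite values by symmetry. *)
Lemma linear_machine_dipole (R : realType) (alpha u v : int) (h m s : nat) :
  u = alpha - 2 * m%:Z + s%:Z -> v = alpha + 2 * h%:Z + 2 * m%:Z - s%:Z ->
  let d : R := ('C(s, m)%:R - 'C(s, m + h)%:R) / 2 ^+ s in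
  [/\ linear_machine (dipole R u v) s alpha = d,
      linear_machine (dipole R u v) s (alpha + 2 * h%:Z) = - d &
      forall j, ~~ (2 %| j - alpha)%Z -> linear_machine (dipole R u v) s j = 0].
Proof.
move=> uE vE d; split=> [||j jp]; rewrite linear_machineE.
- rewrite iter_pascalB {1}(_ : alpha = u + 2 * m%:Z - s%:Z); last lia.
  rewrite iter_pascal_delta (_ : alpha = v + s%:Z - 2 * (m + h)%:Z); last lia.
  by rewrite iter_pascal_delta_sym.
- rewrite iter_pascalB {1}(_ : alpha + _ = u + 2 * (m + h)%:Z - s%:Z); last lia.
  rewrite iter_pascal_delta (_ : alpha + _ = v + s%:Z - 2 * m%:Z); last lia.
  by rewrite iter_pascal_delta_sym -mulNr opprB.
- rewrite (@iter_pascal_parity _ (alpha + s%:Z)) ?mul0r//; last lia.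
  move=> i ip; rewrite /dipole.
  have -> : (i == u) = false by apply: contraNF ip => /eqP->; lia.
  have -> : (i == v) = false by apply: contraNF ip => /eqP->; lia.
  by rewrite subrr.
Qed.

Lemma starting_configuration_parity p f0 : finite_set (supp f0) ->
  on_parity p f0 -> starting_configuration f0.
Proof.
move=> ff0 pf0; split=> //.
have h j : supp f0 j -> (2 %| j - p)%Z.
  by apply: contraPT => /pf0 fj; rewrite /supp /= fj.
have [p0|p1] := boolP (2 %| p)%Z; [left|right] => j /h jp /=.
  by exists (j %/ 2)%Z; lia.
by exists (j %/ 2)%Z; lia.
Qed.

(** The sites that matter are [alpha = a - 1] and [beta], the one among [a + n - 1]
    and [a + n] of the parity of [alpha]; their distance [2 * h] is [n] or [n + 1].
    The starting parity is the one for which the odd piles at time [t] reach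
    [alpha] at time [T - 1]. *)
Lemma interval_discrepancy (R : realType) (a : int) n (B T : nat) :
  (0 < B)%N -> (B <= n)%N ->
  exists f0, starting_configuration f0 /\ exists f, liar_evolution f0 f /\
    \sum_(s < T) (if (B ^ 2 <= s)%N then B%:R / (36 * s%:R) else 0) <=
    \sum_(k < n) (real_config R (f T) (a + k%:Z)
                  - linear_machine (real_config R f0) T (a + k%:Z)).
Proof.
move=> B0 Bn; pose h := uphalf n.
have Bh : (B <= 2 * h)%N by rewrite /h; lia.
have /choice[m mP] : forall s, exists m : nat, (uphalf s <= m)%N /\
    (if (B ^ 2 <= s)%N then B%:R / (36 * s%:R) else 0) <=
    ('C(s, m)%:R - 'C(s, m + h)%:R) / 2 ^+ s :> R.
  by move=> s; have [m] := exists_binomial_drop_total R s B0 Bh; exists m.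
pose alpha := a - 1.
pose s (t : nat) := (T - t.+1)%N.
pose u t := alpha - 2 * (m (s t))%:Z + (s t)%:Z.
pose v t := alpha + 2 * h%:Z + 2 * (m (s t))%:Z - (s t)%:Z.
have uv t : u t < v t by rewrite /u /v; have [] := mP (s t); lia.
pose rho t j := (t < T)%N && ((j == u t) || (j == v t)).
(* Spins beyond [M] are too far away to affect the interval by time [T]. *)
pose M := a + n%:Z + T%:Z.
have [||f0 [f [ff0 pf0 ef fr]]] := @parity_forcing (alpha + T%:Z - 1) rho M T.
- move=> t; apply: (@sub_finite_set _ _ [set` [:: u t; v t]]); last exact: finite_seq.
  by move=> j /= /andP[_]; rewrite !inE.
- move=> t j /andP[tT /orP[]/eqP->]; rewrite /u /v /s; lia.
exists f0; split; first exact: starting_configuration_parity pf0.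
exists f; split=> //; case: ef => f00 fS.
have /choice[chi chiP] : forall t, exists chi, liar_chi (f t) chi /\
    forall j, 2 * (f t.+1 j)%:Z =
      (f t (j - 1))%:Z + (f t (j + 1))%:Z + chi (j - 1) - chi (j + 1).
  by move=> t; have [chi ? ?] := fS t; exists chi.
under [leRHS]eq_bigr => k _ do
  rewrite (@liar_discrepancy R f0 f chi _ _ f00 (fun t => (chiP t).2)).
rewrite exchange_big /= (reindex_inj rev_ord_inj) /=.
apply: ler_sum => -[t tT] _ /=; rewrite -/(s t).
(* Of the four sites left by telescoping, [a] and one at the right end have the
   parity that the dipole never reaches. *)
rewrite telescope_two; apply: le_trans (mP (s t)).2 _.
have chiE j : j <= M -> (chi t j)%:~R = dipole R (u t) (v t) j.
  move=> jM; rewrite (liar_chi_pair (uv t) (chiP t).1 _ jM).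
    by rewrite rmorphB /= !rmorph_nat.
  by move=> i iM; rewrite fr// /rho tT.
have phiE j : j <= a + n%:Z -> linear_machine (fun i => (chi t i)%:~R) (s t) j =
    linear_machine (dipole R (u t) (v t)) (s t) j.
  move=> jn; rewrite !linear_machineE; congr (_ / _).
  apply: iter_pascal_local jn => i iM; apply: chiE.
  by rewrite /M; rewrite /s in iM; lia.
have [dal dbe d0] := linear_machine_dipole R (erefl (u t)) (erefl (v t)).
rewrite !phiE; try lia.
rewrite dal (d0 a); last by rewrite /alpha; lia.
have [n_odd|n_even] := boolP (odd n).
  rewrite (d0 (a + n%:Z - 1)); last by rewrite /alpha; lia.
  rewrite (_ : a + n%:Z = alpha + 2 * h%:Z); last by rewrite /alpha /h; lia.
  rewrite dbe; lra.
rewrite (d0 (a + n%:Z)); last by rewrite /alpha; lia.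
rewrite (_ : a + n%:Z - 1 = alpha + 2 * h%:Z); last by rewrite /alpha /h; lia.
rewrite dbe; lra.
Qed.

(** * Lower bounds *)

Lemma gain_sum_ge (R : realType) (B T : nat) : (0 < B)%N -> (B ^ 2 <= T)%N ->
  B%:R / 36 * ln (T%:R / B%:R ^+ 2) <=
  \sum_(s < T) (if (B ^ 2 <= s)%N then B%:R / (36 * s%:R) else 0) :> R.
Proof.
move=> B0 BT.
rewrite -(big_mkord xpredT (fun s => if (B ^ 2 <= s)%N then B%:R / (36 * s%:R) else 0 : R)).
rewrite (big_cat_nat (n := B ^ 2)%N)//= big1_seq ?add0r => [|s]; last first.
  by rewrite mem_index_iota => /andP[_ /andP[_ sB]]; rewrite leqNgt sB.
have -> : \sum_(B ^ 2 <= s < T) (if (B ^ 2 <= s)%N then B%:R / (36 * s%:R) else 0 : R) =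
    B%:R / 36 * \sum_(B ^ 2 <= s < T) s%:R^-1.
  rewrite mulr_sumr; apply: eq_big_nat => s /andP[-> _].
  by rewrite invfM mulrA.
rewrite ler_wpM2l ?divr_ge0// -natrX ln_ratio_le_sum//.
by rewrite expn_gt0 B0.
Qed.

Lemma liar_interval_lower_bound (R : realType) (a b : int) (B T : nat) : a <= b ->
  (0 < B)%N -> B%:Z <= b - a + 1 -> (B ^ 2 <= T)%N ->
  exists f0 : int -> nat, starting_configuration f0 /\
  exists f : nat -> int -> nat, liar_evolution f0 f /\
    B%:R / 36 * ln (T%:R / B%:R ^+ 2) <=
    `|sum_on (real_config R (f T)) (zinterval a b)
      - sum_on (linear_machine (real_config R f0) T) (zinterval a b)|.
Proof.
move=> ab B0 Bab BT.
have -> : b = a + `|b - a|%N%:Z by lia.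
have [|f0 [sf0 [f [ef fE]]]] := @interval_discrepancy R a `|b - a|%N.+1 B T B0.
  lia.
exists f0; split=> //; exists f; split=> //.
rewrite !sum_on_zinterval -sumrB (le_trans _ (ler_norm _))//.
exact: le_trans (gain_sum_ge R B0 BT) fE.
Qed.

Lemma ln4_ge (R : realType) : 3 / 4 <= ln (4 : R).
Proof.
have /le_ln1Dx : -1 < - (3 / 4) :> R by lra.
rewrite (_ : 1 + - (3 / 4) = 4^-1); last lra.
by rewrite lnV ?posrE//; lra.
Qed.

Theorem corollary8 (R : realType) :
  exists (c : R) (T0 : nat), 0 < c /\
  forall T : nat, (T0 <= T)%N ->
    (forall N : int,
       exists f0 : int -> nat, starting_configuration f0 /\
       exists f : nat -> int -> nat, liar_evolution f0 f /\
         `|real_config R (f T) N - linear_machine (real_config R f0) T N|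
           >= c * ln T%:R)
    /\
    (forall a b : int, 1 <= b - a ->
       exists f0 : int -> nat, starting_configuration f0 /\
       exists f : nat -> int -> nat, liar_evolution f0 f /\
         `|sum_on (real_config R (f T)) (zinterval a b)
           - sum_on (linear_machine (real_config R f0) T) (zinterval a b)|
           >= c * (let B : R := (b - a)%:~R in
                   if Num.sqrt T%:R / 2 < B then Num.sqrt T%:R
                   else B * ln (T%:R / B ^+ 2))).
Proof.
(* [sqrt T >= 4] ensures that the integer part [q] of [sqrt T / 2] is at least
   [sqrt T / 4]; then [q / 36 * ln 4 >= sqrt T / 4 / 36 * (3 / 4) = sqrt T / 192]. *)
exists (1 / 192), 16%N; split=> [|T T16]; first lra.
have T0 : (0 : R) < T%:R by rewrite ltr0n; lia.
pose r : R := Num.sqrt T%:R.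
have r2 : r ^+ 2 = T%:R by rewrite sqr_sqrtr ?ltW.
have r4 : 4 <= r.
  rewrite -(ler_pXn2r (n := 2)) ?nnegrE ?sqrtr_ge0// r2 -natrX ler_nat; lia.
split=> [N|a b ab].
  have [||f0 [sf0 [f [ef fE]]]] := @liar_interval_lower_bound R N N 1 T (lexx N) isT; [lia|lia|].
  exists f0; split=> //; exists f; split=> //.
  have NE : zinterval N N = [set N].
    by apply/seteqP; split=> i; rewrite /zinterval /= => ?; lia.
  move: fE; rewrite NE /sum_on !fsbig_set1 expr1n divr1; apply: le_trans.
  have : 0 <= ln T%:R :> R by rewrite ln_ge0// ler1n; lia.
  lra.
pose B := `|b - a|%N.
have BE : (b - a)%:~R = B%:R :> R.
  by rewrite (_ : b - a = B%:Z) -?pmulrn// /B; lia.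
rewrite /= BE -/r; case: ltP => rB.
  pose q := Num.truncn (r / 2).
  have /truncn_itv/andP[] : 0 <= r / 2 by lra.
  rewrite -/q -[q.+1%:R]natr1 => qr rq.
  have q0 : (0 < q)%N by rewrite -(ltr0n R); lra.
  have q0' : (0 : R) < q%:R by rewrite ltr0n.
  have qB : (q <= B)%N by rewrite -(ler_nat R); lra.
  have qT : (q ^ 2 <= T)%N by rewrite -(ler_nat R) natrX -r2 ler_pXn2r ?nnegrE//; lra.
  have [||f0 [sf0 [f [ef fE]]]] := @liar_interval_lower_bound R a b q T _ q0 _ qT; try (rewrite /B in qB; lia).
  exists f0; split=> //; exists f; split=> //; apply: le_trans fE.
  have : 3 / 4 <= ln (T%:R / q%:R ^+ 2) :> R.
    apply: le_trans (ln4_ge R) _; rewrite ler_ln ?posrE ?divr_gt0 ?exprn_gt0//.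
    by rewrite ler_pdivlMr ?exprn_gt0// -r2; nra.
  nra.
have B0 : (0 < B)%N by rewrite /B; lia.
have BR : (1 : R) <= B%:R by rewrite ler1n.
have BT4 : 4 * B%:R ^+ 2 <= T%:R :> R by rewrite -r2; nra.
have BT : (B ^ 2 <= T)%N by rewrite -(ler_nat R) natrX; nra.
have [||f0 [sf0 [f [ef fE]]]] := @liar_interval_lower_bound R a b B T _ B0 _ BT; try (rewrite /B; lia).
exists f0; split=> //; exists f; split=> //; apply: le_trans fE.
have : 0 <= ln (T%:R / B%:R ^+ 2) :> R.
  by rewrite ln_ge0// ler_pdivlMr ?exprn_gt0//; nra.
nra.
Qed.
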